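(* Let $\mathcal{M}$ be a reduction monoid with group of units $\mathcal{M}^*$, let $a\in\mathcal{M}$ with $|a|>1$, and let $a=p_1\cdots p_r=q_1\cdots q_s$ be two decompositions of the element $a$ into irreducible factors $p_1,\ldots,p_r,q_1,\ldots,q_s\in\mathcal{M}$. Then: 1. $r=s$ and $|p_1|=|q_{\sigma(1)}|,\ldots,|p_r|=|q_{\sigma(r)}|$ for some permutation $\sigma\in S_r$; and 2. if the two decompositions are distinct, then one can be obtained from the other by finitely many transformations on adjacent irreducible factors of the following two types (each transforming a decomposition of $a$ into irreducible factors into another such decomposition): (a) $p_1\cdots p_ip_{i+1}\cdots p_r=p_1\cdots (p_iu)(u^{-1}p_{i+1})\cdots p_r$, where $u\in\mathcal{M}^*$; (b) $p_1\cdots p_ip_{i+1}\cdots p_r=p_1\cdots p_i'p_{i+1}'\cdots p_r$, where $p_i',p_{i+1}'$ are irreducible, $p_ip_{i+1}=p_i'p_{i+1}'$, the numbers $|p_i|$ and $|p_{i+1}|$ are co-prime, $|p_i|=|p_{i+1}'|$ and $|p_{i+1}|=|p_i'|$.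
   Context: A multiplicative monoid $\mathcal{M}$ (with group of units $\mathcal{M}^*$) is called a reduction monoid if the following axioms hold for all elements $a,b,c\in\mathcal{M}$. (A1) $\mathcal{M}$ is an abelian group under an addition $+$ such that $(a+b)c=ac+bc$. (A2) There is a map $|\cdot|:\mathcal{M}\to\mathbb{N}=\{0,1,2,\ldots\}$ such that $|ab|=|a||b|$ and $|a+b|\le\max\{|a|,|b|\}$. (A3) $a\in\mathcal{M}^*$ if and only if $|a|=1$. (A4) If $ac=bc$ then $a=b$, provided $|c|>1$. (A5) For any elements $a,b\in\mathcal{M}$ with $|a|>1$ and $|b|>1$ such that there exists an element $x\in\mathcal{M}a\cap\mathcal{M}b$ with $|x|\neq 0$, there exists an element $c\in\mathcal{M}$ such that $\mathcal{M}a\cap\mathcal{M}b=\mathcal{M}c$ and $|c|=\mathrm{lcm}(|a|,|b|)$. (A6) If $\alpha a=\beta b$ with $|\alpha|=i$, $|a|=jk$, $|\beta|=j$, $|b|=ik$, $ijk\ge 1$, and the natural numbers $i$ and $j$ are co-prime, then $a=a_1c$ and $b=b_1c$ for some elements $a_1,b_1,c\in\mathcal{M}$ such that $|c|=k$. An element of $\mathcal{M}$ is irreducible if it is not a unit and is not a product of two non-units. $S_r$ denotes the symmetric group on $\{1,\ldots,r\}$. *)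

(* Defs.v *)
From HB Require Import structures.
From Stdlib Require Export Relation_Operators.
From mathcomp Require Export all_boot fingroup perm ssralg.

Set Implicit Arguments.
Unset Strict Implicit.
Unset Printing Implicit Defensive.

Local Open Scope group_scope.

Section MonoidNotions.
Variable M : monoidType.
Implicit Types a p u v : M.

Definition mutual_inverse u v : Prop := u * v = 1 /\ v * u = 1.

(* Membership in the group of units M^* *)
Definition is_unit u : Prop := exists v, mutual_inverse u v.

(* x \in M a *)
Definition in_lmul a (x : M) : Prop := exists m : M, x = m * a.

Definition irreducible_elt p : Prop :=
  ~ is_unit p /\ ~ exists x y : M, [/\ ~ is_unit x, ~ is_unit y & p = x * y].

Definition irr_decomposition a (s : seq M) : Prop :=
  (forall p, p \in s -> irreducible_elt p) /\ \prod_(p <- s) p = a.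

End MonoidNotions.

(* Only right distributivity is required: [M] is a near-ring, not a ring, so
   the multiplication is the [monoidType] one (scope %g) while the addition is
   the [zmodType] one (scope %R). *)
HB.mixin Record Zmodule_isReductionMonoid M
    of GRing.Zmodule M & Monoid M := {
  addmulDl : forall a b c : M, (a + b)%R * c = ((a * c)%g + (b * c)%g)%R;
  rmnorm : M -> nat;
  rmnormM : forall a b : M, rmnorm (a * b) = (rmnorm a * rmnorm b)%N;
  rmnormD : forall a b : M,
    (rmnorm (a + b)%R <= maxn (rmnorm a) (rmnorm b))%N;
  rmnorm_unit : forall a : M, is_unit a <-> rmnorm a = 1%N;
  rm_mulIg : forall a b c : M, (1 < rmnorm c)%N -> a * c = b * c -> a = b;
  rm_lcm : forall a b : M, (1 < rmnorm a)%N -> (1 < rmnorm b)%N ->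
    (exists x : M, [/\ in_lmul a x, in_lmul b x & rmnorm x <> 0%N]) ->
    exists c : M,
      (forall x : M, (in_lmul a x /\ in_lmul b x) <-> in_lmul c x) /\
      rmnorm c = lcmn (rmnorm a) (rmnorm b);
  rm_gcd : forall (al be a b : M) (i j k : nat),
    al * a = be * b ->
    rmnorm al = i -> rmnorm a = (j * k)%N ->
    rmnorm be = j -> rmnorm b = (i * k)%N ->
    (1 <= i * j * k)%N -> coprime i j ->
    exists a1 b1 c : M, [/\ a = a1 * c, b = b1 * c & rmnorm c = k]
}.

#[short(type="reductionMonoidType")]
HB.structure Definition ReductionMonoid :=
  {M of GRing.Zmodule M & Monoid M & Zmodule_isReductionMonoid M}.

Section Transformations.
Variable M : reductionMonoidType.

Definition unit_move (s t : seq M) : Prop :=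
  exists (s1 s2 : seq M) (x y u v : M),
    [/\ mutual_inverse u v,
        s = s1 ++ [:: x, y & s2] &
        t = s1 ++ [:: x * u, v * y & s2]].

Definition swap_move (s t : seq M) : Prop :=
  exists (s1 s2 : seq M) (x y x' y' : M),
    [/\ s = s1 ++ [:: x, y & s2],
        t = s1 ++ [:: x', y' & s2],
        irreducible_elt x' /\ irreducible_elt y' &
        [/\ x * y = x' * y', coprime (rmnorm x) (rmnorm y),
            rmnorm x = rmnorm y' & rmnorm y = rmnorm x']].

Definition decomposition_move (a : M) (s t : seq M) : Prop :=
  [/\ irr_decomposition a s, irr_decomposition a t &
      unit_move s t \/ swap_move s t].

End Transformations.

(* Main.v *)
From Stdlib Require Import Classical.
Require Import Defs.

Set Implicit Arguments.
Unset Strict Implicit.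
Unset Printing Implicit Defensive.

Local Open Scope group_scope.

(** The theorem is a unique factorization statement in the style of Ore,
    proved by induction on |a| by comparing the last factors x and y of two
    decompositions a = P x = Q y.  Since a is a common left multiple of x and y
    of nonzero norm, x and y have a least common left multiple
    c = al x = be y with |c| = lcm(|x|, |y|).  Multiplicativity of the norm then
    makes |al| and |be| coprime, with |x| = |be| g and |y| = |al| g for
    g = gcd(|x|, |y|) ([least_common_left_multiple]).

    If g > 1, then (A6) applied to al x = be y gives x and y a common right
    factor of norm g.  It is not a unit, so irreducibility forces both cofactors
    to be units, and x = u y with u a unit ([irreducible_common_factor]).
    Moving u to the left neighbour of x is a transformation of type (a), after
    which the last factors agree; cancelling them leaves two decompositions of
    Q, to which the induction hypothesis applies.

    If g = 1, then |al| = |y| and |be| = |x| are coprime, and (A6) shows that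
    al and be inherit irreducibility from y and x ([irreducible_transfer]).
    Writing a = d c and decomposing d into irreducible factors, one gets
    P = d al and Q = d be by right cancellation.  The induction hypothesis for P
    and for Q reduces the claim to the passage from d al x to d be y, which is
    a transformation of type (b) ([connected_coprime]).

    The first assertion of the theorem is a consequence of the second:
    each transformation only permutes the sequence of norms
    ([perm_norm_moves]). *)

Section ReductionMonoidFactorization.
Variable M : reductionMonoidType.
Implicit Types (a b c d p q u v x y : M) (s t : seq M).

(** * Units and irreducible elements in terms of the norm *)

Lemma norm1_inverse u : rmnorm u = 1%N -> exists v, mutual_inverse u v.
Proof. by move/rmnorm_unit. Qed.

Lemma mutual_inverse_norm u v :
  mutual_inverse u v -> rmnorm u = 1%N /\ rmnorm v = 1%N.
Proof. by case=> uv vu; split; apply/rmnorm_unit; [exists v | exists u]. Qed.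

Lemma irreducible_norm_neq1 p : irreducible_elt p -> rmnorm p <> 1%N.
Proof. by case=> nu _ /rmnorm_unit. Qed.

Lemma irreducible_norm_factor p x y :
  irreducible_elt p -> p = x * y -> rmnorm x = 1%N \/ rmnorm y = 1%N.
Proof.
move=> [_ np] pxy.
have [->|/eqP x1] := eqVneq (rmnorm x) 1%N; first by left.
have [->|/eqP y1] := eqVneq (rmnorm y) 1%N; first by right.
by case: np; exists x, y; split=> // /rmnorm_unit.
Qed.

Lemma irreducible_of_norm p : rmnorm p <> 1%N ->
  (forall x y, p = x * y -> rmnorm x <> 1%N -> rmnorm y = 1%N) ->
  irreducible_elt p.
Proof.
move=> p1 pP; split=> [/rmnorm_unit //|[x [y [nx ny pxy]]]].
by apply/ny/rmnorm_unit/(pP x) => // /rmnorm_unit.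
Qed.

Lemma irreducible_mul_unitl u p :
  rmnorm u = 1%N -> irreducible_elt p -> irreducible_elt (u * p).
Proof.
move=> u1 ip; have [v uv] := norm1_inverse u1.
have [_ v1] := mutual_inverse_norm uv; case: uv => _ vu.
apply: irreducible_of_norm => [|x y upxy x1].
  by rewrite rmnormM u1 mul1n; apply: irreducible_norm_neq1.
have pE : p = (v * x) * y by rewrite -mulgA -upxy mulgA vu mul1g.
by case: (irreducible_norm_factor ip pE) => //; rewrite rmnormM v1 mul1n.
Qed.

Lemma irreducible_mul_unitr u p :
  rmnorm u = 1%N -> irreducible_elt p -> irreducible_elt (p * u).
Proof.
move=> u1 ip; have [v uv] := norm1_inverse u1.
have [_ v1] := mutual_inverse_norm uv; case: uv => uv _.
apply: irreducible_of_norm => [|x y upxy x1].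
  by rewrite rmnormM u1 muln1; apply: irreducible_norm_neq1.
have pE : p = x * (y * v) by rewrite mulgA -upxy -mulgA uv mulg1.
by case: (irreducible_norm_factor ip pE) => //; rewrite rmnormM v1 muln1.
Qed.

(** * Decompositions into irreducible factors *)

Lemma irr_decomposition_rcons a s x :
  irr_decomposition a s -> irreducible_elt x ->
  irr_decomposition (a * x) (rcons s x).
Proof.
move=> [is_ <-] ix; split=> [p|]; last by rewrite -cats1 big_cat big_seq1.
by rewrite mem_rcons inE => /predU1P[->|/is_].
Qed.

Lemma irr_decomposition_rconsP a s x : irr_decomposition a (rcons s x) ->
  exists b, [/\ a = b * x, irr_decomposition b s & irreducible_elt x].
Proof.
move=> [is_ <-]; exists (\prod_(p <- s) p).
split; first by rewrite -cats1 big_cat big_seq1.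
  by split=> // p ps; apply: is_; rewrite mem_rcons inE ps orbT.
by apply: is_; rewrite mem_rcons mem_head.
Qed.

Lemma irr_decomposition_unit a s :
  irr_decomposition a s -> rmnorm a = 1%N -> s = [::].
Proof.
case/lastP: s => // s x /irr_decomposition_rconsP[b [-> _ ix]].
rewrite rmnormM => /eqP; rewrite muln_eq1 => /andP[_ /eqP x1].
by case: (irreducible_norm_neq1 ix).
Qed.

Lemma irr_decomposition_cat a b s t :
  irr_decomposition a s -> irr_decomposition b t ->
  irr_decomposition (a * b) (s ++ t).
Proof.
move=> [is_ <-] [it <-]; split; last by rewrite big_cat.
by move=> p; rewrite mem_cat => /orP[/is_|/it].
Qed.

Lemma irr_decomposition_nil : irr_decomposition (1 : M) [::].
Proof. by split=> //; rewrite big_nil. Qed.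

(** Norms strictly decrease along proper factorizations, so splitting stops.
    Whether an element splits at all is not decidable, hence the appeal to
    excluded middle. *)
Lemma exists_irr_decomposition a :
  (1 < rmnorm a)%N -> exists s, irr_decomposition a s.
Proof.
have [n] := ubnP (rmnorm a); elim: n a => // n IHn a.
rewrite ltnS => le_an a_gt1.
have [ia|nia] := classic (irreducible_elt a).
  exists [:: a]; rewrite -{1}(mul1g a).
  exact: irr_decomposition_rcons irr_decomposition_nil ia.
have [[x [y [x1 y1 axy]]]|nxy] := classic (exists x y,
    [/\ rmnorm x <> 1%N, rmnorm y <> 1%N & a = x * y]); last first.
  case: nia; apply: irreducible_of_norm => [a1|x y axy x1].
    by rewrite a1 in a_gt1.
  by apply: NNPP => y1; apply: nxy; exists x, y.
have xy_a : rmnorm a = (rmnorm x * rmnorm y)%N by rewrite axy rmnormM.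
have [x_gt1 y_gt1] : (1 < rmnorm x /\ 1 < rmnorm y)%N.
  by move: x1 y1 a_gt1; rewrite xy_a; case: (rmnorm x) => [|[|?]] //;
    case: (rmnorm y) => [|[|?]] //; rewrite muln0.
have [|//|s xs] := IHn x.
  by apply: leq_trans le_an; rewrite xy_a ltn_Pmulr // ltnW.
have [|//|t yt] := IHn y.
  by apply: leq_trans le_an; rewrite xy_a ltn_Pmull // ltnW.
by exists (s ++ t); rewrite axy; apply: irr_decomposition_cat.
Qed.

(** * Least common left multiples *)

(** The multiplicativity of the norm turns |c| = lcm(|x|, |y|) into coprimality
    of the cofactors [al] and [be], with [k] = gcd(|x|, |y|); this is the form
    in which axiom (A6) can be applied to [al * x = be * y]. *)
Lemma least_common_left_multiple b c x y : b * x = c * y ->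
  (0 < rmnorm (b * x)%g)%N -> (1 < rmnorm x)%N -> (1 < rmnorm y)%N ->
  exists d al be k, [/\ b = d * al, c = d * be, al * x = be * y,
    coprime (rmnorm al) (rmnorm be) &
    rmnorm x = (rmnorm be * k)%N /\ rmnorm y = (rmnorm al * k)%N].
Proof.
move=> bxcy bx_gt0 x_gt1 y_gt1.
have [|e [eP e_lcm]] := rm_lcm _ _ x_gt1 y_gt1.
  exists (b * x); split; [by exists b | by exists c | ].
  by case: (rmnorm _) bx_gt0.
have [|[al e_al] [be e_be]] := (eP e).2; first by exists 1; rewrite mul1g.
have [|d bx_de] := (eP (b * x)).1; first by split; [exists b | exists c].
have x_gt0 := ltnW x_gt1; have y_gt0 := ltnW y_gt1.
set k := gcdn (rmnorm x) (rmnorm y).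
have k_gt0 : (0 < k)%N by rewrite gcdn_gt0 x_gt0.
have al_k : rmnorm y = (rmnorm al * k)%N.
  apply/eqP; rewrite -(eqn_pmul2l x_gt0) -muln_lcm_gcd -e_lcm e_al rmnormM.
  by rewrite mulnCA mulnA.
have be_k : rmnorm x = (rmnorm be * k)%N.
  apply/eqP; rewrite -(eqn_pmul2r y_gt0) -muln_lcm_gcd -e_lcm e_be rmnormM.
  by rewrite mulnAC.
exists d, al, be, k; split=> //.
- by apply: (rm_mulIg _ _ _ x_gt1); rewrite bx_de e_al mulgA.
- by apply: (rm_mulIg _ _ _ y_gt1); rewrite -bxcy bx_de e_be mulgA.
- by rewrite -e_al.
- by rewrite /coprime -(eqn_pmul2r k_gt0) mul1n muln_gcdl -al_k -be_k gcdnC.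
Qed.

(** Axiom (A6) provides a common right factor of norm [k] of [x] and [y].  As
    [k] differs from 1 it is not a unit, so its cofactors in the irreducible
    elements [x] and [y] are units, and [u] is their quotient. *)
Lemma irreducible_common_factor al be x y k : al * x = be * y ->
  irreducible_elt x -> irreducible_elt y -> (0 < rmnorm (al * x)%g)%N ->
  coprime (rmnorm al) (rmnorm be) -> k <> 1%N ->
  rmnorm x = (rmnorm be * k)%N -> rmnorm y = (rmnorm al * k)%N ->
  exists2 u, rmnorm u = 1%N & x = u * y.
Proof.
move=> alx_bey ix iy; rewrite rmnormM => alx_gt0 co k1 xk yk.
have [|x1 [y1 [c [x_x1c y_y1c ck]]]] :=
  rm_gcd _ _ _ _ _ _ _ alx_bey erefl xk erefl yk _ co;
  first by rewrite -mulnA -xk.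
have [x1_1|] := irreducible_norm_factor ix x_x1c; last by rewrite ck.
have [y1_1|] := irreducible_norm_factor iy y_y1c; last by rewrite ck.
have [z y1z] := norm1_inverse y1_1; have [_ z1] := mutual_inverse_norm y1z.
exists (x1 * z); first by rewrite rmnormM x1_1 z1.
by rewrite y_y1c mulgA -(mulgA x1) y1z.2 mulg1 -x_x1c.
Qed.

(** If [al = v * w] then [v * (w * x) = be * y], and |v| divides |y|, hence is
    coprime to |be| = |x|; so (A6) gives a right factor of norm |w| of [y], with
    cofactor of norm |v|.  A proper factorization of [al] would thus yield one
    of [y]. *)
Lemma irreducible_transfer al be x y : al * x = be * y ->
  (0 < rmnorm (al * x)%g)%N -> irreducible_elt y ->
  rmnorm al = rmnorm y -> rmnorm be = rmnorm x ->
  coprime (rmnorm x) (rmnorm y) -> irreducible_elt al.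
Proof.
move=> alx_bey; rewrite rmnormM => alx_gt0 iy al_y be_x co.
apply: irreducible_of_norm => [|v w al_vw v1].
  by rewrite al_y; apply: irreducible_norm_neq1.
have y_vw : rmnorm y = (rmnorm v * rmnorm w)%N by rewrite -al_y al_vw rmnormM.
have v_wx : v * (w * x) = be * y by rewrite mulgA -al_vw.
have wx_norm : rmnorm (w * x) = (rmnorm x * rmnorm w)%N.
  by rewrite rmnormM mulnC.
have [||y1 [y2 [c [_ y_y2c c_w]]]] :=
  rm_gcd _ _ _ _ _ _ _ v_wx erefl wx_norm be_x y_vw.
- by rewrite mulnAC -y_vw -al_y.
- by rewrite coprime_sym; apply: coprime_dvdr co; rewrite y_vw dvdn_mulr.
have y_gt0 : (0 < rmnorm y)%N.
  by rewrite -al_y; move: alx_gt0; rewrite muln_gt0 => /andP[].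
have [y2_1|<-//] := irreducible_norm_factor iy y_y2c.
case: v1; apply/eqP; have w_gt0 : (0 < rmnorm w)%N.
  by move: y_gt0; rewrite y_vw muln_gt0 => /andP[].
by rewrite -(eqn_pmul2r w_gt0) -y_vw y_y2c rmnormM y2_1 c_w.
Qed.

(** * Transformations of decompositions *)

Notation moves a := (clos_refl_trans (seq M) (decomposition_move a)).

Lemma moves_rcons a s t x : irreducible_elt x ->
  moves a s t -> moves (a * x) (rcons s x) (rcons t x).
Proof.
move=> ix; elim=> {s t} [s t [sa ta st]|s|s t w _ IHst _ IHtw].
- apply: rt_step; split; try exact: irr_decomposition_rcons.
  case: st => [[s1 [s2 [y [z [u [v [uv -> ->]]]]]]]|].
    by left; exists s1, (rcons s2 x), y, z, u, v; rewrite !rcons_cat.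
  case=> [s1 [s2 [y [z [y' [z' [-> -> ? ?]]]]]]].
  by right; exists s1, (rcons s2 x), y, z, y', z'; rewrite !rcons_cat.
- exact: rt_refl.
- exact: rt_trans IHst IHtw.
Qed.

Lemma perm_norm_moves a s t :
  moves a s t -> perm_eq (map (@rmnorm M) s) (map (@rmnorm M) t).
Proof.
elim=> {s t} [s t [_ _ [|]]|s|s t w _ IHst _ IHtw] //; last 1 first.
- exact: perm_trans IHst IHtw.
- case=> [s1 [s2 [x [y [u [v [uv -> ->]]]]]]].
  have [u1 v1] := mutual_inverse_norm uv.
  by rewrite !map_cat /= !rmnormM u1 v1 muln1 mul1n.
- case=> [s1 [s2 [x [y [x' [y' [-> -> _ [_ _ xy' yx']]]]]]]].
  rewrite !map_cat perm_cat2l /= xy' yx'.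
  exact: permEl (perm_catCA [:: rmnorm y'] [:: rmnorm x'] _).
Qed.

(** * Connectedness of the decompositions of an element *)

(** Case of coprime last factors, assuming connectedness for the two products
    of the remaining factors: both decompositions are joined to ones sharing
    all but the last two factors, and these differ by one swap.  When [d] is a
    unit it has no irreducible factors to place on the left, and is absorbed
    into [al] and [be] instead; the factorization [d = e * u] below, with [u] a
    unit, covers both situations. *)
Lemma connected_coprime b c d al be x y s t :
  b = d * al -> c = d * be -> al * x = be * y -> (0 < rmnorm (b * x)%g)%N ->
  irreducible_elt x -> irreducible_elt y -> coprime (rmnorm x) (rmnorm y) ->
  rmnorm al = rmnorm y -> rmnorm be = rmnorm x ->
  (forall w, irr_decomposition b w -> moves b s w) ->
  (forall w, irr_decomposition c w -> moves c w t) ->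
  moves (b * x) (rcons s x) (rcons t y).
Proof.
move=> b_dal c_dbe alx_bey bx_gt0 ix iy co al_y be_x s_b c_t.
have [d_gt0 alx_gt0] : (0 < rmnorm d /\ 0 < rmnorm (al * x)%g)%N.
  by apply/andP; rewrite -muln_gt0 -rmnormM mulgA -b_dal.
have ial : irreducible_elt al.
  exact: irreducible_transfer alx_bey alx_gt0 iy al_y be_x co.
have ibe : irreducible_elt be.
  apply: (irreducible_transfer (esym alx_bey)) ix be_x al_y _.
    by rewrite -alx_bey.
  by rewrite coprime_sym.
have [e [u [w [d_eu u1 we]]]] :
    exists e u w, [/\ d = e * u, rmnorm u = 1%N & irr_decomposition e w].
  move: d_gt0; rewrite leq_eqVlt => /predU1P[/esym d1|d_gt1].
    by exists 1, d, [::]; rewrite mul1g; split=> //;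
      apply: irr_decomposition_nil.
  have [w wd] := exists_irr_decomposition d_gt1.
  by exists d, 1, w; rewrite mulg1; split=> //; apply/rmnorm_unit; exists 1;
    split; rewrite mulg1.
have iual := irreducible_mul_unitl u1 ial.
have iube := irreducible_mul_unitl u1 ibe.
have b_e : b = e * (u * al) by rewrite b_dal d_eu mulgA.
have c_e : c = e * (u * be) by rewrite c_dbe d_eu mulgA.
have wb : irr_decomposition b (rcons w (u * al)).
  by rewrite b_e; apply: irr_decomposition_rcons.
have wc : irr_decomposition c (rcons w (u * be)).
  by rewrite c_e; apply: irr_decomposition_rcons.
have bx_cy : b * x = c * y by rewrite b_e c_e -!mulgA alx_bey.
apply: rt_trans (moves_rcons ix (s_b _ wb)) _.
apply: rt_trans; last by rewrite bx_cy; apply: moves_rcons iy (c_t _ wc).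
apply: rt_step; split; first exact: irr_decomposition_rcons.
  by rewrite bx_cy; apply: irr_decomposition_rcons.
right; exists w, [::], (u * al), x, (u * be), y.
rewrite -!cats1 -!catA; split=> //; split.
- by rewrite -!mulgA alx_bey.
- by rewrite rmnormM u1 mul1n al_y coprime_sym.
- by rewrite rmnormM u1 mul1n.
- by rewrite rmnormM u1 mul1n be_x.
Qed.

(** Units are included (they have only the empty decomposition) because the
    induction passes to the cofactor of a last factor, which may be a unit. *)
Theorem decomposition_connected a s t : (0 < rmnorm a)%N ->
  irr_decomposition a s -> irr_decomposition a t -> moves a s t.
Proof.
have [n] := ubnP (rmnorm a); elim: n a s t => // n IHn a s t.
rewrite ltnS => le_an a_gt0 sa ta.
have [a1|a_neq1] := eqVneq (rmnorm a) 1%N.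
  rewrite (irr_decomposition_unit sa a1) (irr_decomposition_unit ta a1).
  exact: rt_refl.
have norm1 : rmnorm (1 : M) = 1%N.
  by apply/rmnorm_unit; exists 1; split; rewrite mulg1.
have nil_unit b : irr_decomposition b [::] -> rmnorm b = 1%N.
  by case=> _ <-; rewrite big_nil.
case/lastP: s sa => [/nil_unit/eqP|s x]; first by rewrite (negPf a_neq1).
case/irr_decomposition_rconsP=> b [a_bx sb ix].
case/lastP: t ta => [/nil_unit/eqP|t y]; first by rewrite (negPf a_neq1).
case/irr_decomposition_rconsP=> c [a_cy tc iy].
have irr_gt1 e z : a = e * z -> irreducible_elt z ->
    [/\ 1 < rmnorm z, 0 < rmnorm e & rmnorm e < n]%N.
  move=> a_ez iz; have := a_gt0; rewrite a_ez rmnormM muln_gt0.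
  case/andP=> e_gt0 z_gt0; have z_gt1 : (1 < rmnorm z)%N.
    by rewrite ltn_neqAle z_gt0 andbT eq_sym; apply/eqP/irreducible_norm_neq1.
  by split=> //; apply: leq_trans le_an; rewrite a_ez rmnormM ltn_Pmulr.
have [x_gt1 b_gt0 lt_bn] := irr_gt1 b x a_bx ix.
have [y_gt1 c_gt0 lt_cn] := irr_gt1 c y a_cy iy.
have bx_cy : b * x = c * y by rewrite -a_bx.
have bx_gt0 : (0 < rmnorm (b * x)%g)%N by rewrite -a_bx.
have [d [al [be [k [b_dal c_dbe alx_bey co [xk yk]]]]]] :=
  least_common_left_multiple bx_cy bx_gt0 x_gt1 y_gt1.
have [k1|/eqP k1] := eqVneq k 1%N.
  rewrite k1 !muln1 in xk yk; rewrite a_bx.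
  apply: (connected_coprime b_dal c_dbe) => //.
  - by rewrite xk yk coprime_sym.
  - by move=> w wb; apply: IHn.
  - by move=> w wc; apply: IHn.
have [|u u1 x_uy] := irreducible_common_factor alx_bey ix iy _ co k1 xk yk.
  by move: bx_gt0; rewrite b_dal -mulgA rmnormM muln_gt0 => /andP[].
have [v uv] := norm1_inverse u1.
have c_bu : c = b * u by apply: (rm_mulIg _ _ _ y_gt1);
  rewrite -bx_cy x_uy mulgA.
case/lastP: s sb => [sb|s z /irr_decomposition_rconsP[e [b_ez se iz]]].
  (* No left neighbour is available to absorb [u], but then [c] is a unit, so
     that [t] is empty as well and [x = a = y]. *)
  have c1 : rmnorm c = 1%N by rewrite c_bu rmnormM (nil_unit b sb) u1.
  have t0 := irr_decomposition_unit tc c1; rewrite t0 in tc *.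
  have -> : x = y; last exact: rt_refl.
  by move: bx_cy; rewrite -sb.2 -tc.2 big_nil !mul1g.
have c_zu : c = e * (z * u) by rewrite c_bu b_ez mulgA.
have izu := irreducible_mul_unitr u1 iz.
have zuc : irr_decomposition c (rcons s (z * u)).
  by rewrite c_zu; apply: irr_decomposition_rcons.
apply: (@rt_trans _ _ _ (rcons (rcons s (z * u)) y)); last first.
  by rewrite a_cy; apply: moves_rcons iy (IHn c _ _ lt_cn c_gt0 zuc tc).
apply: rt_step; split.
- by rewrite a_bx b_ez; do 2![apply: irr_decomposition_rcons => //].
- by rewrite a_cy; apply: irr_decomposition_rcons.
left; exists s, [::], z, x, u, v; rewrite -!cats1 -!catA; split=> //.
by rewrite x_uy mulgA uv.2 mul1g.
Qed.

End ReductionMonoidFactorization.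

(** * The factorization theorem *)

Theorem theorem1p1 (M : reductionMonoidType) (a : M) (ha : (1 < rmnorm a)%N)
    (r s : nat) (p : r.-tuple M) (q : s.-tuple M)
    (hp : irr_decomposition a p) (hq : irr_decomposition a q) :
  (r = s /\
   exists sigma : 'S_r, forall i : 'I_r,
     rmnorm (tnth p i) = rmnorm (nth 1%g q (sigma i)))
  /\
  (tval p <> tval q ->
   clos_refl_trans (seq M) (decomposition_move a) p q).
Proof.
have pq := decomposition_connected (ltnW ha) hp hq.
split=> //; have npq := perm_norm_moves pq.
have rs : r = s by have := perm_size npq; rewrite !size_map !size_tuple.
split=> //; rewrite -{s}rs in q hq pq npq *.
have /tuple_permP[sigma sigmaE] :
  perm_eq (map_tuple (@rmnorm M) p) (map_tuple (@rmnorm M) q) := npq.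
exists sigma => i; rewrite -tnth_nth.
have := congr1 (fun t => tnth t i) (val_inj sigmaE).
by rewrite !tnth_map tnth_ord_tuple.
Qed.
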